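(* The subspace $A_0$ is not complemented in $\ell_\infty$; that is, there is no bounded linear operator $P: \ell_\infty \to A_0$ such that $Px = x$ for every $x \in A_0$.
   Context: $\mathbb{N}$ is the set of positive integers. $\ell_\infty$ is the space of all bounded real sequences $x=(x_1,x_2,\ldots)$ with the norm $\|x\| = \sup_{n\in\mathbb{N}} |x_n|$. For $x\in\ell_\infty$ put $\alpha(x) = \limsup_{i\to\infty} \max_{i<j\leq 2i} |x_i - x_j|$, and let $A_0 = \{x\in\ell_\infty : \alpha(x)=0\}$, a linear subspace of $\ell_\infty$ endowed with the norm of $\ell_\infty$. *)

(* Defs.v *)
From HB Require Import structures.
From mathcomp Require Import all_boot all_order all_algebra.
From mathcomp Require Import boolp classical_sets functions reals.
From mathcomp Require Import topology normedtype sequences.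

Set Implicit Arguments.
Unset Strict Implicit.
Unset Printing Implicit Defensive.

Import Order.TTheory GRing.Theory Num.Theory.
Import numFieldNormedType.Exports.

Local Open Scope classical_set_scope.
Local Open Scope ring_scope.

Section bounded_sequences.
Variable R : realType.

Definition bounded_seq : {pred nat -> R} := fun x => `[< bounded_fun x >].

Lemma bounded_seqP (x : nat -> R) :
  x \in bounded_seq <-> exists M, forall n, `|x n| <= M.
Proof.
rewrite unfold_in; split => [/asboolP|[M xM]].
  move=> [M [_ xM]]; exists (M + 1) => n; apply: xM => //.
  by rewrite ltrDl.
apply/asboolP; exists M; split; first exact: num_real.
by move=> y My n _ /=; rewrite (le_trans (xM n))// ltW.
Qed.

Fact bounded_seq_submod_closed : submod_closed bounded_seq.
Proof.
split.
  by apply/bounded_seqP; exists 0 => n; rewrite normr0.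
move=> a x y /bounded_seqP[M xM] /bounded_seqP[N yN].
apply/bounded_seqP; exists (`|a| * M + N) => n.
rewrite (le_trans (ler_normD _ _))// lerD// normrM.
by rewrite ler_wpM2l.
Qed.

HB.instance Definition _ :=
  GRing.isSubmodClosed.Build R (nat -> R) bounded_seq bounded_seq_submod_closed.

Record ell_infty := EllInfty {
  seq_of :> nat -> R;
  seq_ofP : seq_of \in bounded_seq }.

HB.instance Definition _ := [isSub for seq_of].
HB.instance Definition _ := [Choice of ell_infty by <:].
HB.instance Definition _ := [SubChoice_isSubLmodule of ell_infty by <:].

Definition sup_norm (x : ell_infty) : R := sup (range (fun n => `|x n|)).

Lemma sup_norm_has_sup (x : ell_infty) : has_sup (range (fun n => `|x n|)).
Proof.
split; first by exists `|x 0%N|, 0%N.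
by have /bounded_seqP[M xM] := seq_ofP x; exists M => _ [n _ <-].
Qed.

Lemma le_sup_norm (x : ell_infty) n : `|x n| <= sup_norm x.
Proof. by apply: sup_upper_bound; [exact: sup_norm_has_sup|exists n]. Qed.

Lemma sup_norm_le (x : ell_infty) M : (forall n, `|x n| <= M) -> sup_norm x <= M.
Proof.
move=> xM; apply: ge_sup; first by case: (sup_norm_has_sup x).
by move=> _ [n _ <-].
Qed.

Fact ler_sup_normD (x y : ell_infty) :
  sup_norm (x + y) <= sup_norm x + sup_norm y.
Proof.
apply: sup_norm_le => n.
by rewrite (le_trans (ler_normD _ _))// lerD// le_sup_norm.
Qed.

Fact sup_normZ (a : R) (x : ell_infty) : sup_norm (a *: x) = `|a| * sup_norm x.
Proof.
have leZ b y : sup_norm (b *: y) <= `|b| * sup_norm y.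
  by apply: sup_norm_le => n; rewrite normrM ler_wpM2l// le_sup_norm.
apply/eqP; rewrite eq_le leZ/=.
have [->|a0] := eqVneq a 0.
  by rewrite normr0 mul0r (le_trans _ (le_sup_norm _ 0%N)).
rewrite -ler_pdivlMl ?normr_gt0// -normfV.
by rewrite -{1}(scalerK a0 x) leZ.
Qed.

Fact sup_norm0_eq0 (x : ell_infty) : sup_norm x = 0 -> x = 0.
Proof.
move=> x0; apply: val_inj; apply: funext => n /=.
by apply/eqP; rewrite -normr_le0 -x0 le_sup_norm.
Qed.

HB.instance Definition _ := Lmodule_isNormed.Build R ell_infty
  ler_sup_normD sup_normZ sup_norm0_eq0.

(* Sequences are stored from index 0, the mathematical x = (x_1, x_2, ...)
   from index 1; term x n is x_n for n >= 1 (term x 0 is meaningless). *)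
Definition term (x : ell_infty) (n : nat) : R := x n.-1.

(* max_{i < j <= 2i} |x_i - x_j|; the default value 0 of the maximum only
   matters at the spurious index i = 0, which does not affect alpha. *)
Definition osc (x : ell_infty) (i : nat) : R :=
  \big[Num.max/0]_(i.+1 <= j < (2 * i)%N.+1) `|term x i - term x j|.

Definition alpha (x : ell_infty) : R := limn_sup (osc x).

Definition A0 : set ell_infty := [set x | alpha x = 0].

End bounded_sequences.

(* Main.v *)
Require Import Defs.
From HB Require Import structures.
From mathcomp Require Import finmap.
From mathcomp Require Import all_boot all_order all_algebra.
From mathcomp Require Import boolp classical_sets functions cardinality reals.
From mathcomp Require Import topology normedtype sequences.
Set Implicit Arguments.
Unset Strict Implicit.
Unset Printing Implicit Defensive.

Import Order.TTheory GRing.Theory Num.Theory.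
Import numFieldNormedType.Exports.
Local Open Scope classical_set_scope.
Local Open Scope ring_scope.

(** A0 contains every finitely supported sequence, and the proof rests on
    Whitley's argument for the classical fact (Phillips, Sobczyk) that c_0 is
    not complemented in the space of bounded sequences.

    Take continuum many infinite sets of natural numbers whose pairwise
    intersections are finite: the branches of the binary tree.  If a bounded
    functional f kills all finitely supported sequences, then on finitely many
    indicators of such sets, after discarding finitely many coordinates, the
    sets are disjoint, so any combination with coefficients of modulus at most
    1 has norm at most 1; choosing the coefficients as the signs of the values
    of f shows that the sum of these |values| is bounded by the norm of f.
    Hence f is nonzero at only countably many of the indicators
    (countable_functional_support).

    If P were a bounded projection onto A0, all coordinate functionals of
    id - P would be of this kind, and there are countably many of them.  So
    some branch would have an indicator fixed by P, hence in A0.  But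
    consecutive terms of a sequence of A0 get arbitrarily close, whereas the
    branches are made of even numbers only, so that their indicators jump from
    1 to 0 infinitely often. *)

(** * Membership in A0 *)

Lemma osc_ge0 (R : realType) (x : ell_infty R) i : 0 <= osc x i.
Proof.
rewrite /osc; elim/big_rec: _ => // j y _ y0.
by rewrite le_max y0 orbT.
Qed.

Lemma osc_le (R : realType) (x : ell_infty R) i : osc x i <= `|x| + `|x|.
Proof.
rewrite /osc; elim/big_rec: _ => [|j y _ yx]; first by rewrite addr_ge0.
rewrite ge_max yx andbT (le_trans (ler_normB _ _))// lerD//; exact: le_sup_norm.
Qed.

(** In the osc indexing the terms x n and x n.+1 have indices n.+1 and n.+2. *)
Lemma consecutive_le_osc (R : realType) (x : ell_infty R) n :
  `|x n - x n.+1| <= osc x n.+1.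
Proof.
rewrite /osc big_ltn ?le_max ?lexx//.
by rewrite mul2n -addnn addnS addSn !ltnS leq_addl.
Qed.

Lemma A0_consecutive (R : realType) (x : ell_infty R) (e : R) :
  0 < e -> A0 x -> exists N, forall n, (N <= n)%N -> `|x n - x n.+1| < e.
Proof.
move=> e0 Ax.
have ubd : has_ubound (range (osc x)).
  by exists (`|x| + `|x|) => _ [n _ <-]; exact: osc_le.
have lbd : has_lbound (range (osc x)).
  by exists 0 => _ [n _ <-]; exact: osc_ge0.
have cvg0 : sups (osc x) @ \oo --> (0 : R^o).
  rewrite -[X in _ --> X]Ax.
  exact: cvgP (@cvg_sups_inf R (osc x) ubd lbd).
have /cvgrPdist_lt/(_ _ e0)[N _ HN] := cvg0.
exists N => n Nn; rewrite (le_lt_trans (consecutive_le_osc x n))//.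
rewrite (le_lt_trans _ (HN _ Nn))//= sub0r normrN.
apply: le_trans (ler_norm _); apply: sup_upper_bound; last first.
  by exists n.+1 => /=.
split; first by exists (osc x n), n => /=.
by exists (`|x| + `|x|) => _ [k _ <-]; exact: osc_le.
Qed.

Lemma finite_support_A0 (R : realType) (x : ell_infty R) N :
  (forall n, (N <= n)%N -> x n = 0) -> A0 x.
Proof.
move=> x0; rewrite /A0/= /alpha.
apply: (cvg_limn_inf_sup _).2; apply/cvgrPdist_lt => e e0.
exists N.+1 => // i /= Ni; suff -> : osc x i = 0 by rewrite subrr normr0.
rewrite /osc big_nat; elim/big_rec: _ => // j y /andP[ij _] ->.
rewrite /term !x0 ?subrr ?normr0 ?maxxx//; last first.
  by case: i Ni {ij}.
by case: j ij => // j; rewrite ltnS => /(leq_trans Ni)/ltnW.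
Qed.

(** * Functionals vanishing on finitely supported sequences *)

Lemma indicator_bounded (R : realType) (E : pred nat) :
  (fun n => (E n)%:R : R) \in @bounded_seq R.
Proof.
by apply/bounded_seqP; exists 1 => n; rewrite ger0_norm ?lern1 ?leq_b1.
Qed.

(** The indicator sequence of the set E, as a bounded sequence. *)
Definition indicator (R : realType) (E : pred nat) : ell_infty R :=
  EllInfty (indicator_bounded R E).

Lemma tail_bounded (R : realType) (N : nat) (x : ell_infty R) :
  (fun n => (N <= n)%N%:R * x n) \in @bounded_seq R.
Proof.
apply/bounded_seqP; exists `|x| => n.
rewrite normrM ger0_norm// (le_trans _ (le_sup_norm x n))//.
by rewrite ler_piMl// lern1 leq_b1.
Qed.

(** The sequence x with its terms of index less than N replaced by 0. *)
Definition tail (R : realType) (N : nat) (x : ell_infty R) : ell_infty R :=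
  EllInfty (tail_bounded N x).

(** Distinct members of the family E have a finite, i.e. bounded,
    intersection. *)
Definition almost_disjoint (I : eqType) (E : I -> pred nat) :=
  forall i j, i != j -> exists N, forall n, (N <= n)%N -> ~~ (E i n && E j n).

Lemma seq_of_sum (R : realType) (I : Type) (s : seq I) (F : I -> ell_infty R)
    n :
  (\sum_(i <- s) F i : ell_infty R) n = \sum_(i <- s) F i n.
Proof. by elim/big_rec2: _ => // i y z _ <-. Qed.

(** Beyond some index at most one of the indicators is nonzero. *)
Lemma almost_disjoint_sum_le1 (R : realType) (I : eqType) (E : I -> pred nat)
    (a : I -> R) (s : seq I) :
  almost_disjoint E -> (forall i, `|a i| <= 1) -> uniq s ->
  exists N, forall n, (N <= n)%N -> `|\sum_(i <- s) a i * (E i n)%:R| <= 1.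
Proof.
move=> disj a1; elim: s => [|i s IH] /=.
  by exists 0%N => n _; rewrite big_nil normr0.
move=> /andP[is_ /IH[N HN]].
have [M HM] : exists M, forall n, (M <= n)%N ->
    forall j, j \in s -> ~~ (E i n && E j n).
  elim: s is_ {IH HN} => [|j s IHs]; first by exists 0%N.
  rewrite inE negb_or => /andP[ij /IHs[M HM]].
  have [K HK] := disj _ _ ij.
  exists (maxn M K) => n; rewrite geq_max => /andP[Mn Kn] l.
  by rewrite inE => /orP[/eqP->|]; [exact: HK|exact: HM].
exists (maxn M N) => n; rewrite geq_max => /andP[Mn Nn].
rewrite big_cons; case Ein: (E i n); last by rewrite mulr0 add0r HN.
rewrite big_seq big1 ?addr0 ?mulr1// => j js.
by have := HM n Mn j js; rewrite Ein /= => /negbTE ->; rewrite mulr0.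
Qed.

Section functional_support.
Variables (R : realType) (I : choiceType) (E : I -> pred nat).
Variables (f : {scalar ell_infty R}) (C : R).
Hypothesis disjE : almost_disjoint E.
Hypothesis f_bounded : forall x, `|f x| <= C * `|x|.
Hypothesis f_finite_support :
  forall (x : ell_infty R) N,
    (forall n, (N <= n)%N -> x n = 0) -> f x = 0.

Lemma functional_tail N (x : ell_infty R) : f (tail N x) = f x.
Proof.
apply/eqP; rewrite -subr_eq0 -linearB; apply/eqP.
apply: (f_finite_support (N := N)) => n Nn.
by rewrite -[LHS]/((N <= n)%N%:R * x n - x n) Nn mul1r subrr.
Qed.

(** The left-hand side is the value of f at the combination of the indicators
    with the signs of their images as coefficients; some tail of that
    combination has norm at most 1. *)
Lemma functional_sum_le (s : seq I) :
  uniq s -> \sum_(i <- s) `|f (indicator R (E i))| <= `|C|.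
Proof.
move=> us; pose a i := Num.sg (f (indicator R (E i))).
have a1 i : `|a i| <= 1 by rewrite normr_sg lern1 leq_b1.
have [N HN] := almost_disjoint_sum_le1 disjE a1 us.
pose y : ell_infty R := \sum_(i <- s) a i *: indicator R (E i).
have <- : f y = \sum_(i <- s) `|f (indicator R (E i))|.
  by rewrite linear_sum; apply: eq_bigr => i _; rewrite linearZ /= normrEsg.
rewrite -(functional_tail N) (le_trans (ler_norm _))//.
rewrite (le_trans (f_bounded _))//.
rewrite (le_trans (ler_norm _))// normrM normr_id ler_piMr//.
apply: sup_norm_le => n /=; case: (leqP N n) => Nn; last first.
  by rewrite mul0r normr0.
by rewrite mul1r seq_of_sum; exact: HN.
Qed.

(** The sum of the |f (indicator R (E i))| over any k such indices i is at
    least k * e, hence k <= |C| / e. *)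
Lemma finite_functional_ge (e : R) : 0 < e ->
  finite_set [set i | e <= `|f (indicator R (E i))|].
Proof.
move=> e0; apply: contrapT => inf.
pose k := (Num.truncn (`|C| / e)).+1.
have [B Be kB] := infinite_set_fset k inf.
have : k%:R * e <= `|C|.
  apply: le_trans (functional_sum_le (fset_uniq B)).
  apply: (@le_trans _ _ (\sum_(i <- B) e)).
    rewrite big_const_seq count_predT iter_addr_0 -[leRHS]mulr_natl.
    by rewrite ler_pM2r// ler_nat.
  by rewrite big_seq [leRHS]big_seq ler_sum// => i iB; apply: Be.
by rewrite leNgt -ltr_pdivrMr// truncnS_gt.
Qed.

Lemma countable_functional_support :
  countable [set i | f (indicator R (E i)) != 0].
Proof.
apply: (@sub_countable _ _ _
    (\bigcup_(k in [set: nat])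
      [set i | k.+1%:R^-1 <= `|f (indicator R (E i))|])).
  apply: subset_card_le => i /= fi0.
  have := normr_gt0 (f (indicator R (E i))); rewrite fi0 => f0.
  exists (Num.truncn `|f (indicator R (E i))|^-1) => //=.
  by rewrite -[leRHS]invrK lef_pV2 ?posrE ?invr_gt0// ltW// truncnS_gt.
apply: bigcup_countable => // k _; apply: finite_set_countable.
by apply: finite_functional_ge; rewrite invr_gt0.
Qed.

End functional_support.

(** * The branches of the binary tree *)

(** The set of the even numbers 2 * c, where c encodes a finite prefix of g. *)
Definition branch (g : nat -> bool) : pred nat := fun n =>
  ~~ odd n &&
  (if pickle_inv n./2 is Some s then (s : seq bool) == mkseq g (size s)
   else false).

Lemma branch_prefix g k : branch g (pickle (mkseq g k)).*2.
Proof. by rewrite /branch odd_double doubleK pickleK_inv size_mkseq eqxx. Qed.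

Lemma branchP g n :
  branch g n -> exists k, n = (pickle (mkseq g k)).*2.
Proof.
move=> /andP[nodd]; case Es: (pickle_inv n./2) => [s|//] /eqP gs.
exists (size s); rewrite -gs.
have := @pickle_invK (seq bool) n./2; rewrite Es /= => ->.
by rewrite even_halfK.
Qed.

Lemma branch_infinite g N : exists2 n, (N <= n)%N & branch g n.
Proof.
pose h k := (pickle (mkseq g k)).*2.
have h_inj : injective h.
  move=> k l /double_inj/(pcan_inj pickleK)/(congr1 size).
  by rewrite !size_mkseq.
apply: contrapT => small.
have hN k : (h k < N)%N.
  rewrite ltnNge; apply/negP => Nh; apply: small.
  by exists (h k) => //; exact: branch_prefix.
have /leq_card : injective (fun i : 'I_N.+1 => Ordinal (hN i)).
  by move=> i j /(congr1 val)/= /h_inj/val_inj.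
by rewrite !card_ord ltnn.
Qed.

(** Two distinct sequences only share the prefixes ending before the first
    index where they differ. *)
Lemma almost_disjoint_branch : almost_disjoint branch.
Proof.
move=> g h gh.
have [k ghk] : exists k, g k != h k.
  apply: contrapT => ghE; move/negP: gh; apply; apply/eqP/funext => k.
  by apply: contrapT => /eqP ghk; apply: ghE; exists k.
exists (\max_(j < k.+1) (pickle (mkseq g j)).*2).+1 => n len.
apply/negP => /andP[/branchP[l nl] /branchP[m]]; rewrite nl.
move=> /double_inj/(pcan_inj pickleK) glhm.
have lm : l = m by have := congr1 size glhm; rewrite !size_mkseq.
have kl : (k < l)%N.
  rewrite ltnNge; apply/negP => lk; move: len; rewrite ltnNge => /negP; apply.
  by rewrite nl (leq_bigmax (Ordinal (lk : (l < k.+1)%N))).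
move/negP: ghk; apply; apply/eqP.
by have := congr1 (nth false ^~ k) glhm; rewrite /= !nth_mkseq// -lm.
Qed.

Lemma uncountable_bool_seq : ~ countable [set: nat -> bool].
Proof.
move=> /countable_injP[c c_inj].
(* Cantor's diagonal: g differs at the index c h from every h. *)
pose g n := ~~ `[< exists2 h, c h = n & h n >].
suff gE : g (c g) = ~~ g (c g) by case: (g (c g)) gE.
rewrite {1}/g; congr (~~ _); apply/asboolP/idP => [[h]|gg]; last by exists g.
by move=> /(c_inj _ _ (in_setT _) (in_setT _)) ->.
Qed.

Lemma indicator_branch_notin_A0 (R : realType) g :
  ~ A0 (indicator R (branch g)).
Proof.
move=> /(A0_consecutive (@ltr01 R))[N HN].
have [n Nn gn] := branch_infinite g N.
(* n is even, so n.+1 is not in the branch *)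
have gSn : branch g n.+1 = false.
  by case/andP: gn => nodd _; rewrite /branch /= nodd.
by have := HN n Nn; rewrite /= gn gSn subr0 normr1 ltxx.
Qed.

(** * Non-complementation *)

Theorem theorem3p2 (R : realType) :
  ~ exists P : {linear ell_infty R -> ell_infty R},
      [/\ exists C : R, forall x : ell_infty R, `|P x| <= C * `|x|,
          forall x : ell_infty R, A0 (P x)
        & forall x : ell_infty R, A0 x -> P x = x].
Proof.
move=> [P [[C PC] PA0 PK]].
pose f n (x : ell_infty R) : R := (x - P x : ell_infty R) n.
have f_lin n : linear_for *%R (f n).
  by move=> a x y; rewrite /f linearP opprD addrACA -scalerBr.
pose fl n : {scalar ell_infty R} :=
  HB.pack (f n) (GRing.isLinear.Build _ _ _ _ (f n) (f_lin n)).
have fl_bounded n x : `|fl n x| <= (1 + C) * `|x|.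
  apply: (le_trans (le_sup_norm (x - P x) n)).
  by rewrite mulrDl mul1r (le_trans (ler_normB x (P x)))// lerD2l.
have fl_finite n (x : ell_infty R) N :
    (forall m, (N <= m)%N -> x m = 0) -> fl n x = 0.
  by move=> /finite_support_A0/PK; rewrite /= /f => ->; rewrite subrr.
apply: uncountable_bool_seq.
apply: (@sub_countable _ _ _ (\bigcup_(n in [set: nat])
    [set g | fl n (indicator R (branch g)) != 0])).
  apply: subset_card_le => g _; apply: contrapT => fl0.
  apply: (@indicator_branch_notin_A0 R g).
  suff <- : P (indicator R (branch g)) = indicator R (branch g) by exact: PA0.
  apply/esym/subr0_eq/val_inj/funext => n; apply: contrapT => /eqP fn0.
  by apply: fl0; exists n.
apply: bigcup_countable => // n _.
exact: (countable_functional_support almost_disjoint_branch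
          (fl_bounded n) (fl_finite n)).
Qed.
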